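(* Let $n$ be an odd positive integer and $x,a,b>0$. Let $\mathcal{W}_n$ be the dicot with vertices $u_0,\dots,u_{2n-1}$ (indices mod $2n$), solid edges $\{u_p,u_{p+1}\}$ ($0\le p\le 2n-1$) each oriented from the endpoint with even index to the endpoint with odd index, dashed edges $\{u_p,u_{p+n}\}$ ($0\le p\le n-1$), vertex weights $x$, solid-edge weights $a$ and dashed-edge weights $b$. Then the partition function of the monopole-dimer model on $\mathcal{W}_n$ is \[ \mathcal{Z}(\mathcal{W}_n)=\prod_{j=0}^{n-1}\left(x^2+b^2+4a^2\cos^2\frac{\pi j}{n}\right)=(x^2+b^2+4a^2)\prod_{j=1}^{(n-1)/2}\left(x^2+b^2+4a^2\cos^2\frac{\pi j}{n}\right)^2. \]
   Context: This $\mathcal{W}_n$ is the wheel dicot of order $n$ (a solid $2n$-cycle with dashed edges joining antipodal vertices; in the paper the even-indexed vertices are labelled $1,\dots,n$ and the odd-indexed ones $n+1,\dots,2n$, solid edges oriented from smaller to larger label). A dicot $\mathcal{G}=[V,A,B]$ consists of a finite vertex set $V$ and two sets $A$ (solid edges) and $B$ (dashed edges) of unordered pairs of distinct vertices, with $[V,A\cup B]$ bipartite; it carries positive vertex weights $x(v)$, solid-edge weights $a(\cdot,\cdot)$, dashed-edge weights $b(\cdot,\cdot)$, and an orientation of its solid edges ($v\to v'$). A loop is a cyclic sequence $(v_1,\dots,v_{2m})$, $m\ge1$, of distinct vertices (up to rotation) traversed $v_1\to\cdots\to v_{2m}\to v_1$, with a chosen edge $e_j$ joining $v_j,v_{j+1}$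 (indices mod $2m$); $m=1$ is a doubled edge, and for $m\ge2$ the two traversal directions give distinct loops. A monopole-dimer configuration is a collection of vertex-disjoint loops, each with an even number of dashed edges; remaining vertices are isolated. Loop weight: $w(\ell)=-\prod_j c_j$ with $c_j=a(v_j,v_{j+1})$ if $e_j$ solid and $v_j\to v_{j+1}$, $c_j=-a(v_j,v_{j+1})$ if $e_j$ solid and $v_{j+1}\to v_j$, $c_j=\mathrm{i}\,b(v_j,v_{j+1})$ if $e_j$ dashed ($\mathrm{i}=\sqrt{-1}$). Configuration weight: product of loop weights times $\prod x(w)$ over isolated vertices $w$. The partition function $\mathcal{Z}$ is the sum of all configuration weights.
   Formalization: Edges are indexed families, not sets of pairs; this matters only for n=1, where the two solid edges {u_0,u_1},{u_1,u_0} count as parallel edges: as a set they collapse to one edge, giving Z=x^2+a^2+b^2, so the formula would fail. *)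

(* Defs.v *)
From HB Require Import structures.
From mathcomp Require Import all_boot all_order all_algebra.
From mathcomp Require Import all_classical all_reals all_analysis.
From mathcomp Require Import complex.
Set Implicit Arguments.
Unset Strict Implicit.
Unset Printing Implicit Defensive.
Import Order.TTheory GRing.Theory Num.Theory.
Local Open Scope ring_scope.
Local Open Scope complex_scope.

(* Edges are finite families of unordered pairs.  When the families are        *)
(* injective (see [wheel_simple]) they are the same thing as sets of pairs;    *)
(* parallel edges are needed only for the wheel of order 1, whose solid        *)
(* 2-cycle consists of two edges with the same ends.                           *)
(* The orientation of a solid edge is given by its initial vertex.             *)
Record dicot := Dicot {
  vertex : finType;
  solid : finType;
  dashed : finType;
  solid_ends : solid -> {set vertex};
  dashed_ends : dashed -> {set vertex};
  solid_tail : solid -> vertex;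
  solid_pair : forall e, #|solid_ends e| = 2%N;
  dashed_pair : forall e, #|dashed_ends e| = 2%N;
  solid_tail_in : forall e, solid_tail e \in solid_ends e;
  dicot_bipartite : exists X : {set vertex},
    (forall e, #|solid_ends e :&: X| = 1%N) /\
    (forall e, #|dashed_ends e :&: X| = 1%N)
}.

Section Loops.
Variable G : dicot.

Definition edge : finType := (solid G + dashed G)%type.

Definition ends (e : edge) : {set vertex G} :=
  match e with inl s => solid_ends s | inr d => dashed_ends d end.

Definition is_dashed (e : edge) : bool :=
  match e with inl _ => false | inr _ => true end.

(* ((v, e), v') stands for the traversal of the edge e from v to v'. *)
Definition step : finType := ((vertex G * edge) * vertex G)%type.
Definition step_src (s : step) : vertex G := s.1.1.
Definition step_edge (s : step) : edge := s.1.2.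
Definition step_tgt (s : step) : vertex G := s.2.

(* As the vertices of a loop are distinct, its cyclic sequence of steps is     *)
(* determined up to rotation by its set of steps, so a loop (a sequence modulo *)
(* rotation) is encoded as that set.  A loop and its reverse are different     *)
(* sets, unless m = 1 and the same edge is used twice.                         *)
Definition is_loop (l : {set step}) : Prop :=
  exists (m : nat) (p : seq step),
  [/\ (1 <= m)%N /\ size p = (2 * m)%N,
      uniq (map step_src p),
      cycle [rel s t | step_tgt s == step_src t] p,
      (forall s, s \in p -> ends (step_edge s) = [set step_src s; step_tgt s])
    & l = [set s in p]].

Definition loop_vertices (l : {set step}) : {set vertex G} :=
  [set step_src s | s in l].

Definition num_dashed (l : {set step}) : nat :=
  #|[set s in l | is_dashed (step_edge s)]|.

Definition is_configuration (C : {set {set step}}) : Prop :=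
  (forall l, l \in C -> is_loop l /\ ~~ odd (num_dashed l)) /\
  (forall l l', l \in C -> l' \in C -> l != l' ->
     [disjoint loop_vertices l & loop_vertices l']).

Definition isolated (C : {set {set step}}) : {set vertex G} :=
  ~: \bigcup_(l in C) loop_vertices l.

Section Weights.
Variables (R : realType).
Variables (x : vertex G -> R) (a : solid G -> R) (b : dashed G -> R).

Definition step_weight (s : step) : R[i] :=
  match step_edge s with
  | inl e => if step_src s == solid_tail e then (a e)%:C else - (a e)%:C
  | inr e => (0 +i* 1) * (b e)%:C
  end.

Definition loop_weight (l : {set step}) : R[i] :=
  - \prod_(s in l) step_weight s.

Definition configuration_weight (C : {set {set step}}) : R[i] :=
  (\prod_(l in C) loop_weight l) * \prod_(v in isolated C) (x v)%:C.

Definition partition_function : R[i] :=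
  \sum_(C : {set {set step}} | `[< is_configuration C >])
    configuration_weight C.

End Weights.
End Loops.

(* The vertex u_p is p : 'I_(n + n); ordS is the successor modulo n + n, while *)
(* lshift n p and rshift n p have values p and n + p.                          *)
Section Wheel.
Variable n : nat.

Definition wheel_solid_ends (p : 'I_(n + n)) : {set 'I_(n + n)} :=
  [set p; ordS p].

Definition wheel_dashed_ends (p : 'I_n) : {set 'I_(n + n)} :=
  [set lshift n p; rshift n p].

Definition wheel_solid_tail (p : 'I_(n + n)) : 'I_(n + n) :=
  if odd p then ordS p else p.

Lemma odd_ordS (p : 'I_(n + n)) : odd (ordS p) = ~~ odd p.
Proof.
case: p => p lt_p /=; case: (ltngtP p.+1 (n + n)%N) => [lt_p1|lt_p1|eq_p].
- by rewrite modn_small.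
- by move: lt_p1; rewrite ltnS leqNgt lt_p.
- by rewrite -[RHS]/(odd p.+1) eq_p modnn oddD addbb.
Qed.

Lemma odd_rshift (p : 'I_n) : odd n -> odd (rshift n p) = ~~ odd (lshift n p).
Proof. by move=> odd_n; rewrite /= oddD odd_n. Qed.

Lemma card_pair_odd (u v : 'I_(n + n)) : odd v = ~~ odd u ->
  #|[set u; v]| = 2%N /\ #|[set u; v] :&: [set w : 'I_(n + n) | odd w]| = 1%N.
Proof.
move=> uv; have neq : u != v.
  by apply/eqP => e; move: uv; rewrite e; case: odd.
split; first by rewrite cards2 neq.
apply/eqP/cards1P; exists (if odd u then u else v).
apply/setP => w; rewrite !inE; case: (eqVneq w u) => [->|wu].
  by case: ifP => /= ou; rewrite ?eqxx // (negPf neq).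
case: (eqVneq w v) => [->|wv] /=; last by case: ifP; rewrite ?(negPf wu) ?(negPf wv).
by rewrite uv; case: ifP => //= _; rewrite ?eqxx // eq_sym (negPf neq).
Qed.

Hypothesis odd_n : odd n.

Lemma wheel_solid_pair p : #|wheel_solid_ends p| = 2%N.
Proof. by have [] := card_pair_odd (odd_ordS p). Qed.

Lemma wheel_dashed_pair p : #|wheel_dashed_ends p| = 2%N.
Proof. by have [] := card_pair_odd (odd_rshift p odd_n). Qed.

Lemma wheel_solid_tail_in p : wheel_solid_tail p \in wheel_solid_ends p.
Proof. by rewrite /wheel_solid_tail !inE; case: ifP; rewrite eqxx ?orbT. Qed.

Lemma wheel_bipartite : exists X : {set 'I_(n + n)},
  (forall p, #|wheel_solid_ends p :&: X| = 1%N) /\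
  (forall p, #|wheel_dashed_ends p :&: X| = 1%N).
Proof.
exists [set w : 'I_(n + n) | odd w]; split=> p.
  by have [] := card_pair_odd (odd_ordS p).
by have [] := card_pair_odd (odd_rshift p odd_n).
Qed.

Definition wheel : dicot :=
  Dicot wheel_solid_pair wheel_dashed_pair wheel_solid_tail_in wheel_bipartite.

Lemma wheel_simple : (1 < n)%N ->
  injective (@solid_ends wheel) /\ injective (@dashed_ends wheel).
Proof.
move=> n_gt1; split=> p q /= /setP epq.
  have := epq p; rewrite !inE eqxx /= => /esym /orP[/eqP //|/eqP pSq].
  have := epq q; rewrite !inE eqxx /= => /orP[/eqP -> //|/eqP qSp].
  have ordS_add2 (r : 'I_(n + n)) : (ordS (ordS r) : nat) = ((r + 2) %% (n + n))%N.
    by rewrite /= -addn1 modnDml addn1 addn2.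
  have /eqP : (p + 2 = p + 0 %[mod n + n])%N.
    by rewrite -ordS_add2 -qSp -pSq addn0 modn_small.
  by rewrite eqn_modDl mod0n modn_small // (leq_add n_gt1 (ltnW n_gt1)).
have := epq (lshift n p); rewrite !inE eqxx /= eq_lrshift orbF => /esym/eqP.
exact: lshift_inj.
Qed.

End Wheel.

(* Main.v *)
(* A loop and its reverse have opposite weights when the loop has an odd number *)
(* of dashed edges, because the graph is bipartite and only solid edges change  *)
(* sign.  Reversing one odd loop of a family therefore shows that the parity    *)
(* condition on configurations may be dropped: the families with an odd loop    *)
(* cancel in pairs.  Families of disjoint loops are the non-trivial cycles of   *)
(* permutations of the vertices, with an edge chosen at each moved vertex; all  *)
(* these cycles are even, so the minus sign of each loop is the signature of    *)
(* its cycle, and the partition function is the determinant of a matrix K.      *)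
(* For the wheel, K = x + a E (S + S^-1) + i b S^n with S the cyclic shift and  *)
(* E = diag((-1)^p).  On the Fourier vectors v_j = (zeta^(j p))_p, where        *)
(* zeta = exp(i pi / n), E exchanges v_j and v_(n+j), so K splits into the 2x2  *)
(* blocks [x + i b (-1)^j, -c; c, x - i b (-1)^j] with c = 2 a cos(pi j / n).   *)

Require Import Defs.
From mathcomp Require Import all_boot all_order all_algebra.
From mathcomp Require Import all_classical all_reals all_analysis.
From mathcomp Require Import complex ring.
From mathcomp Require Import fintype finset path fingraph perm.
Set Implicit Arguments.
Unset Strict Implicit.
Unset Printing Implicit Defensive.
Import Order.TTheory GRing.Theory Num.Theory.
Local Open Scope ring_scope.
Local Open Scope complex_scope.

(** * Cancellation of odd loops *)

(** The determinant of [kasteleyn] expands over permutations of the vertices. Expanding each entry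
    further, a term chooses at every vertex either the vertex weight (a fixed point) or an edge to
    the image, so it traces a family of disjoint loops. [loops_of_inj] and [loops_of_surj] make this
    a bijection, and [configuration_weight_loops_of] matches the weights: bipartiteness makes every
    nontrivial cycle even, hence of sign -1, which is the sign in front of each loop weight.

    This expansion also counts loops with an odd number of dashed edges, which configurations
    forbid. Reversing such a loop negates its weight ([loop_weight_reverse]), so these extra
    families have total weight zero ([partition_function_loop_family]).

    For the wheel, [kasteleyn_fourier] shows that the span of the Fourier vectors of indices j and n
    + j is invariant. Since n is odd, the dashed terms on the two vectors are conjugate, and each
    2x2 block has determinant x^2 + b^2 + 4 a^2 cos^2(pi j / n). The second product comes from
    pairing j with n - j ([prod_nat_odd_symmetric]). *)

Lemma uniq_map_inj_in (S T : eqType) (f : S -> T) (p : seq S) :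
  uniq (map f p) -> {in p &, injective f}.
Proof.
elim: p => //= u p IHp /andP[fu_p Up] s t; rewrite !inE.
case/predU1P=> [->|sp] /predU1P[->|tp] // est; last exact: IHp.
  by move: fu_p; rewrite est map_f.
by move: fu_p; rewrite -est map_f.
Qed.

Section LoopReversal.
Variable G : dicot.
Implicit Types (s : step G) (l : {set step G}) (C : {set {set step G}}).

Definition reverse_step s : step G := ((step_tgt s, step_edge s), step_src s).

Lemma reverse_stepK : involutive reverse_step.
Proof. by case=> [[v e] w]. Qed.

Definition reverse_loop l := reverse_step @: l.

Lemma reverse_loopK : involutive reverse_loop.
Proof.
move=> l; rewrite /reverse_loop -imset_comp -[RHS]imset_id.
by apply: eq_imset => s /=; rewrite reverse_stepK.
Qed.

Lemma loop_src_inj l : is_loop l -> {in l &, injective (@step_src G)}.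
Proof.
by move=> [m [p [_ Up _ _ ->]]] s t; rewrite !inE; apply: uniq_map_inj_in.
Qed.

Lemma loop_ends l s : is_loop l -> s \in l ->
  ends (step_edge s) = [set step_src s; step_tgt s].
Proof. by move=> [m [p [_ _ _ ep ->]]]; rewrite inE; apply: ep. Qed.

Lemma card_loop l : is_loop l -> #|l| != 0%N /\ ~~ odd #|l|.
Proof.
move=> [m [p [[m1 szp] Up _ _ ->]]].
rewrite cardsE (card_uniqP (map_uniq Up)) szp oddM /=.
by case: m m1 {szp}.
Qed.

Lemma loop_next l s : is_loop l -> s \in l ->
  exists2 t, t \in l & step_src t = step_tgt s.
Proof.
move=> [m [p [_ _ cp _ ->]]]; rewrite inE => sp.
by exists (next p s); rewrite ?inE ?mem_next //; apply/esym/eqP/(next_cycle cp).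
Qed.

Lemma loop_prev l s : is_loop l -> s \in l ->
  exists2 t, t \in l & step_tgt t = step_src s.
Proof.
move=> [m [p [_ _ cp _ ->]]]; rewrite inE => sp.
by exists (prev p s); rewrite ?inE ?mem_prev //; apply/eqP/(prev_cycle cp).
Qed.

(** The target of a step is the source of its cyclic successor, and [next] is injective on a
    sequence without repetition. *)
Lemma uniq_loop_tgt (p : seq (step G)) : uniq (map (@step_src G) p) ->
  cycle [rel s t | step_tgt s == step_src t] p -> uniq (map (@step_tgt G) p).
Proof.
move=> Up cp; rewrite map_inj_in_uniq ?(map_uniq Up) // => s t sp tp.
rewrite (eqP (next_cycle cp sp)) (eqP (next_cycle cp tp)).
move/(uniq_map_inj_in Up); rewrite !mem_next => /(_ sp tp).
exact: (can_inj (prev_next (map_uniq Up))).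
Qed.

Lemma loop_tgt_inj l : is_loop l -> {in l &, injective (@step_tgt G)}.
Proof.
move=> [m [p [_ Up cp _ ->]]] s t; rewrite !inE; apply: uniq_map_inj_in.
exact: uniq_loop_tgt.
Qed.

Lemma is_loop_reverse l : is_loop l -> is_loop (reverse_loop l).
Proof.
move=> [m [p [szp Up cp ep ->]]]; exists m, (rev (map reverse_step p)); split.
- by rewrite size_rev size_map.
- rewrite map_rev rev_uniq -map_comp.
  by rewrite (eq_map (_ : _ =1 @step_tgt G)) ?uniq_loop_tgt.
- rewrite rev_cycle cycle_map.
  by apply: sub_cycle cp => s t /=; rewrite eq_sym.
- by move=> s; rewrite mem_rev => /mapP[t tp ->] /=; rewrite setUC; exact: (ep t tp).
- apply/setP => s; rewrite !inE mem_rev.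
  by apply/imsetP/mapP => -[t]; rewrite ?inE => tp ->; exists t; rewrite ?inE.
Qed.

Lemma loop_vertices_reverse l : is_loop l ->
  loop_vertices (reverse_loop l) = loop_vertices l.
Proof.
move=> loop_l; rewrite /loop_vertices /reverse_loop -imset_comp.
apply/setP => v; apply/imsetP/imsetP => -[s sl ->] /=.
  by have [t tl et] := loop_next loop_l sl; exists t => //; exact: esym et.
by have [t tl et] := loop_prev loop_l sl; exists t => //; exact: esym et.
Qed.

Lemma num_dashed_reverse l : num_dashed (reverse_loop l) = num_dashed l.
Proof.
rewrite /num_dashed -[RHS](card_imset _ (can_inj reverse_stepK)).
apply: eq_card => s; rewrite !inE.
apply/andP/imsetP => [[/imsetP[t tl ->] dt]|[t]].
  by exists t; rewrite // inE tl.
by rewrite inE => /andP[tl dt] ->; rewrite imset_f.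
Qed.

Definition loop_family C :=
  (forall l, l \in C -> is_loop l) /\
  (forall l l', l \in C -> l' \in C -> l != l' ->
     [disjoint loop_vertices l & loop_vertices l']).

Lemma loop_vertices_neq0 l : is_loop l -> exists v, v \in loop_vertices l.
Proof.
move=> /card_loop[+ _]; rewrite cards_eq0 => /set0Pn[s sl].
by exists (step_src s); rewrite imset_f.
Qed.

Lemma loop_family_inj C l l' v : loop_family C -> l \in C -> l' \in C ->
  v \in loop_vertices l -> v \in loop_vertices l' -> l = l'.
Proof.
move=> [_ dC] lC l'C vl; apply: contraTeq => ne.
by rewrite (disjointFr (dC _ _ lC l'C ne)).
Qed.

Definition odd_loop l := odd (num_dashed l).

Definition odd_vertices C := \bigcup_(l in C | odd_loop l) loop_vertices l.

(** In a family of disjoint loops at most one passes through [v], so mapping this over the family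
    reverses at most one loop. No vertex set changes, hence disjointness and isolated vertices are
    preserved. *)
Definition reverse_through v l :=
  if v \in loop_vertices l then reverse_loop l else l.

Lemma is_loop_reverse_through v l : is_loop l -> is_loop (reverse_through v l).
Proof. by rewrite /reverse_through; case: ifP => // _; apply: is_loop_reverse. Qed.

Lemma loop_vertices_reverse_through v l : is_loop l ->
  loop_vertices (reverse_through v l) = loop_vertices l.
Proof.
by rewrite /reverse_through; case: ifP => // _; apply: loop_vertices_reverse.
Qed.

Lemma odd_loop_reverse_through v l : odd_loop (reverse_through v l) = odd_loop l.
Proof.
by rewrite /reverse_through /odd_loop; case: ifP; rewrite // num_dashed_reverse.
Qed.

Lemma reverse_throughK v l : is_loop l ->
  reverse_through v (reverse_through v l) = l.
Proof.
move=> loop_l; rewrite {1}/reverse_through loop_vertices_reverse_through //.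
by rewrite /reverse_through; case: (v \in loop_vertices l); rewrite ?reverse_loopK.
Qed.

Lemma reverse_through_inj v C : loop_family C ->
  {in C &, injective (reverse_through v)}.
Proof.
by move=> [lC _]; apply: can_in_inj => l /lC; apply: reverse_throughK.
Qed.

Lemma reverse_throughKs v C : loop_family C ->
  reverse_through v @: (reverse_through v @: C) = C.
Proof.
move=> [lC _]; rewrite -imset_comp -[RHS]imset_id.
by apply: eq_in_imset => l /lC /=; apply: reverse_throughK.
Qed.

Lemma loop_family_reverse_through v C : loop_family C ->
  loop_family (reverse_through v @: C).
Proof.
move=> [lC dC]; split=> [_ /imsetP[l /lC loop_l ->]|].
  exact: is_loop_reverse_through.
move=> _ _ /imsetP[l Cl ->] /imsetP[l' Cl' ->] ne.
rewrite !loop_vertices_reverse_through; try exact: lC.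
by apply: dC => //; apply: contraNneq ne => ->.
Qed.

Lemma odd_vertices_reverse_through v C : loop_family C ->
  odd_vertices (reverse_through v @: C) = odd_vertices C.
Proof.
move=> famC; rewrite /odd_vertices big_imset_cond; last exact: reverse_through_inj.
rewrite (eq_bigl (fun l => (l \in C) && odd_loop l)) => [|l]; last first.
  by rewrite odd_loop_reverse_through.
apply: eq_bigr => l /andP[/famC.1 loop_l _].
exact: loop_vertices_reverse_through.
Qed.

Lemma isolated_reverse_through v C : loop_family C ->
  Defs.isolated (reverse_through v @: C) = Defs.isolated C.
Proof.
move=> famC; rewrite /Defs.isolated big_imset; last exact: reverse_through_inj.
congr (~: _); apply: eq_bigr => l /famC.1.
exact: loop_vertices_reverse_through.
Qed.

(* Reverses the odd loop through a vertex which depends only on the set of     *)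
(* vertices covered by odd loops, so that the map is an involution.            *)
Definition reverse_odd_loop C :=
  if [pick v in odd_vertices C] is Some v then reverse_through v @: C else C.

Lemma loop_family_reverse_odd_loop C : loop_family C ->
  loop_family (reverse_odd_loop C).
Proof.
rewrite /reverse_odd_loop; case: pickP => // v _.
exact: loop_family_reverse_through.
Qed.

Lemma odd_vertices_reverse_odd_loop C : loop_family C ->
  odd_vertices (reverse_odd_loop C) = odd_vertices C.
Proof.
rewrite /reverse_odd_loop; case: pickP => // v _.
exact: odd_vertices_reverse_through.
Qed.

Lemma reverse_odd_loopK C : loop_family C ->
  reverse_odd_loop (reverse_odd_loop C) = C.
Proof.
move=> famC; rewrite {1}/reverse_odd_loop odd_vertices_reverse_odd_loop //.
rewrite /reverse_odd_loop; case: pickP => // v _.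
exact: reverse_throughKs.
Qed.

Lemma is_configurationE C :
  is_configuration C <-> loop_family C /\ odd_vertices C = set0.
Proof.
split=> [[lC dC]|[[lC dC] odd0]].
  split; first by split=> // l /lC[].
  by apply: big1 => l /andP[/lC[_ /negPf]]; rewrite /odd_loop => ->.
split=> // l Cl; split; first exact: lC.
apply: contra_eqN odd0 => odd_l.
have [v vl] := loop_vertices_neq0 (lC l Cl).
by apply/set0Pn; exists v; apply/bigcupP; exists l; rewrite ?Cl.
Qed.

Section Weights.
Variables (R : realType).
Variables (x : vertex G -> R) (a : solid G -> R) (b : dashed G -> R).

Lemma step_weight_reverse s :
  ends (step_edge s) = [set step_src s; step_tgt s] ->
  step_weight a b (reverse_step s)
  = (-1) ^+ (~~ is_dashed (step_edge s)) * step_weight a b s.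
Proof.
case: s => [[v [e|e]] w]; rewrite /step_weight /step_src /step_edge /step_tgt /=.
  move=> ee; have := solid_pair e; have := solid_tail_in e.
  rewrite ee cards2 !inE ![_ == solid_tail e]eq_sym expr1 mulN1r.
  case: (eqVneq (solid_tail e) v) => [->|_] /=; first by case: eqVneq.
  by move=> -> _; rewrite opprK.
by rewrite expr0 mul1r.
Qed.

(** Each solid step changes sign. As the length is even, the numbers of solid and of dashed steps
    have the same parity. *)
Lemma loop_weight_reverse l : is_loop l ->
  loop_weight a b (reverse_loop l) = (-1) ^+ odd_loop l * loop_weight a b l.
Proof.
move=> loop_l; rewrite /loop_weight mulrN; congr (- _).
rewrite big_imset /=; last by move=> s t _ _; apply: (can_inj reverse_stepK).
under eq_bigr => s /(loop_ends loop_l) es do rewrite step_weight_reverse //.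
rewrite big_split /=; congr (_ * _).
(* With the sign of a solid step written this way, the factors -1 multiply to 1 by even length, and
   only the dashed steps remain to be counted. *)
rewrite (eq_bigr (fun s => -1 * (-1) ^+ is_dashed (step_edge s))); last first.
  by move=> s _; case: is_dashed; rewrite ?mulr1 // mulN1r opprK.
rewrite big_split /= prodr_const.
rewrite -[X in X * _]signr_odd (negPf (card_loop loop_l).2) mul1r.
rewrite (bigID (fun s => is_dashed (step_edge s))) /= [X in _ * X]big1 ?mulr1.
  rewrite (eq_bigr (fun=> -1)) => [|s /andP[_ ->]]; last by rewrite expr1.
  by rewrite prodr_const -[LHS]signr_odd /odd_loop /num_dashed cardsE.
by move=> s /andP[_ /negPf ->].
Qed.

Lemma configuration_weight_reverse_odd_loop C :
  loop_family C -> odd_vertices C != set0 ->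
  configuration_weight x a b (reverse_odd_loop C)
  = - configuration_weight x a b C.
Proof.
move=> famC odd_C; rewrite /reverse_odd_loop; case: pickP => [v|no]; last first.
  by case/set0Pn: odd_C => v vC; have := no v; rewrite vC.
case/bigcupP=> l /andP[lC odd_l] vl.
rewrite /configuration_weight isolated_reverse_through // -mulNr.
congr (_ * _); rewrite big_imset /=; last exact: reverse_through_inj.
rewrite (bigD1 l) //= [X in - X](bigD1 l) //= -mulNr; congr (_ * _).
  by rewrite /reverse_through vl loop_weight_reverse ?odd_l ?mulN1r //; apply: famC.1.
apply: eq_bigr => l' /andP[l'C ne]; rewrite /reverse_through.
by case: ifP => // vl'; rewrite (loop_family_inj famC l'C lC vl' vl) eqxx in ne.
Qed.

(** [reverse_odd_loop] is an involution on the families with an odd loop and negates their weights,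
    so their sum Z satisfies Z = -Z. *)
Lemma partition_function_loop_family :
  partition_function x a b =
  \sum_(C | `[< @loop_family C >]) configuration_weight x a b C.
Proof.
rewrite [RHS](bigID (fun C => odd_vertices C == set0)) /=.
set Z := \sum_(C | _ && (_ != _)) _.
suff -> : Z = 0.
  rewrite addr0; apply: eq_bigl => C.
  apply/asboolP/andP => [/is_configurationE[famC ->]|[/asboolP famC /eqP odd0]].
    by split; [apply/asboolP|].
  exact/is_configurationE.
suff: Z = - Z by move=> /eqP; rewrite -addr_eq0 -mulr2n mulrn_eq0 => /eqP.
rewrite {1}/Z (reindex_onto reverse_odd_loop reverse_odd_loop) /=; last first.
  by move=> C /andP[/asboolP famC _]; apply: reverse_odd_loopK.
rewrite -sumrN; apply: eq_big => [C|C /andP[/andP[/asboolP fam' odd'] /eqP eqC]].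
  apply/andP/andP=> [[/andP[/asboolP fam' odd'] /eqP <-]|[/asboolP famC oddC]].
    rewrite odd_vertices_reverse_odd_loop // odd'; split=> //.
    exact/asboolP/loop_family_reverse_odd_loop.
  rewrite odd_vertices_reverse_odd_loop // oddC reverse_odd_loopK // eqxx andbT.
  by split=> //; apply/asboolP/loop_family_reverse_odd_loop.
by rewrite -[in RHS]eqC (configuration_weight_reverse_odd_loop fam' odd') opprK.
Qed.

End Weights.
End LoopReversal.

(** * Loop families as permutations *)

Section PermutationOrbits.
Variables (T : finType) (sigma : {perm T}).
Implicit Types (A : {set T}).

Lemma mem_porbits_eq A v : A \in porbits sigma -> v \in A -> A = porbit sigma v.
Proof. by case/imsetP=> u _ -> vu; apply/eqP; rewrite eq_sym eq_porbit_mem. Qed.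

Lemma porbits_partition : partition (porbits sigma) [set: T].
Proof.
apply/and3P; split.
- apply/eqP/setP => v; rewrite inE; apply/bigcupP; exists (porbit sigma v).
    exact: imset_f.
  exact: porbit_id.
- apply/trivIsetP => A A' AP A'P; apply: contraR => /pred0Pn[v /andP[/= vo vo']].
  by rewrite (mem_porbits_eq AP vo) (mem_porbits_eq A'P vo').
- apply/imsetP => -[u _ /setP/(_ u)].
  by rewrite inE porbit_id.
Qed.

(** A cycle of length k has sign (-1)^(k-1); the exponent k + 1 has the same parity and avoids
    truncated subtraction. *)
Lemma sign_perm_porbits (R : comPzRingType) :
  (-1) ^+ sigma = \prod_(A in porbits sigma) (-1) ^+ #|A|.+1 :> R.
Proof.
under eq_bigr do rewrite exprSr.
rewrite big_split prodr_const prodrXr -(card_partition porbits_partition).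
by rewrite /odd_perm signr_addb !signr_odd cardsT.
Qed.

Lemma porbit_fconnect v w : (w \in porbit sigma v) = fconnect sigma v w.
Proof.
apply/porbitP/idP => [[i ->]|vw].
  by rewrite permX; apply: fconnect_iter.
by exists (findex sigma v w); rewrite permX iter_findex.
Qed.

Lemma porbit_stable A v : A \in porbits sigma -> v \in A -> sigma v \in A.
Proof.
by move=> AP vo; rewrite (mem_porbits_eq AP vo) (mem_porbit sigma 1).
Qed.

Definition moved_orbits := [set A in porbits sigma | (1 < #|A|)%N].

Lemma card_porbit_gt1 A v : A \in porbits sigma -> v \in A ->
  (1 < #|A|)%N = (sigma v != v).
Proof.
move=> AP vo; case: eqP => [fix_v|/eqP mv] /=.
  rewrite ltnNge (mem_porbits_eq AP vo); apply/negbTE; rewrite negbK.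
  apply: (@leq_trans #|[set v]|); last by rewrite cards1.
  apply/subset_leq_card/subsetP => w.
  case/porbitP=> i ->; rewrite inE permX; apply/eqP.
  by elim: i => //= i ->.
by apply/card_gt1P; exists v, (sigma v); rewrite vo porbit_stable // eq_sym.
Qed.

Lemma moved_orbit A v : A \in moved_orbits -> v \in A -> sigma v != v.
Proof. by rewrite inE => /andP[AP A1] vo; rewrite -(card_porbit_gt1 AP vo). Qed.

Lemma mem_moved_orbits v : (porbit sigma v \in moved_orbits) = (sigma v != v).
Proof.
have AP : porbit sigma v \in porbits sigma by apply: imset_f.
by rewrite inE AP (card_porbit_gt1 AP (porbit_id _ _)).
Qed.

Lemma cover_moved_orbits : cover moved_orbits = [set v | sigma v != v].
Proof.
apply/setP => v; rewrite inE; apply/bigcupP/idP => [[A mA vo]|mv].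
  exact: moved_orbit mA vo.
by exists (porbit sigma v); rewrite ?mem_moved_orbits ?porbit_id.
Qed.

Lemma trivIset_moved_orbits : trivIset moved_orbits.
Proof.
apply: trivIsetS (partition_trivIset porbits_partition).
by apply/subsetP => A; rewrite inE => /andP[].
Qed.

End PermutationOrbits.

(** * Permutations with chosen edges, and the determinant expansion *)

Section KasteleynExpansion.
Variable G : dicot.
Local Notation V := (vertex G).
(* The edge chosen at a vertex v leads from v to its image; None stands for a   *)
(* fixed vertex.                                                               *)
Local Notation permutation_edges :=
  ({perm V} * {ffun V -> option (edge G)})%type.
Implicit Types (j : permutation_edges) (A : {set V}) (v w : V).
Implicit Types (C : {set {set step G}}).

Lemma card_ends (e : edge G) : #|ends e| = 2%N.
Proof. by case: e => e; [apply: solid_pair|apply: dashed_pair]. Qed.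

Lemma ends_neq (e : edge G) v w : ends e = [set v; w] -> v != w.
Proof. by move=> ee; have := card_ends e; rewrite ee cards2; case: eqVneq. Qed.

Lemma bipartite_ends : exists X : {set V},
  forall (e : edge G) v w, ends e = [set v; w] -> (w \in X) = (v \notin X).
Proof.
have [X [sX dX]] := dicot_bipartite G; exists X => e v w ee.
have /eqP/cards1P[z eX] : #|ends e :&: X| = 1%N by case: e {ee}.
have vw := ends_neq ee; rewrite ee in eX; move/setP: eX => eX.
have := eX v; have := eX w; have := eX z.
rewrite !inE !eqxx orbT /= => /andP[+ _] -> ->.
by case/orP=> /eqP ->; rewrite ?eqxx ?vw // eq_sym (negPf vw).
Qed.

Definition compatible j := [forall v,
  if j.2 v is Some e then ends e == [set v; j.1 v] else j.1 v == v].

Lemma compatible_ends j v e : compatible j -> j.2 v = Some e ->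
  ends e = [set v; j.1 v].
Proof. by move=> /forallP/(_ v) + fv; rewrite fv => /eqP. Qed.

Lemma compatible_moved j v : compatible j -> (j.1 v != v) = (j.2 v != None).
Proof.
move=> cj; have /forallP/(_ v) := cj.
case fv: (j.2 v) => [e|] => [_|/eqP ->]; last by rewrite eqxx.
by rewrite eq_sym (ends_neq (compatible_ends cj fv)).
Qed.

Definition steps_on j A : {set step G} := [set s : step G |
  [&& step_src s \in A, j.2 (step_src s) == Some (step_edge s)
    & step_tgt s == j.1 (step_src s)]].

Definition loops_of j := steps_on j @: moved_orbits j.1.

Lemma moved_edge j A v : compatible j -> A \in moved_orbits j.1 -> v \in A ->
  exists e, j.2 v = Some e.
Proof.
move=> cj mA vo; have := moved_orbit mA vo; rewrite compatible_moved //.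
by case: (j.2 v) => // e _; exists e.
Qed.

(** On such an orbit the permutation follows edges, so it exchanges the two colour classes; being
    injective both ways, it forces them to meet the orbit in equally many points. *)
Lemma even_moved_orbit j A : compatible j -> A \in moved_orbits j.1 ->
  exists2 m, (1 <= m)%N & #|A| = (2 * m)%N.
Proof.
move=> cj mA; have [X hX] := bipartite_ends.
have := mA; rewrite inE => /andP[AP A1].
have alt v : v \in A -> (j.1 v \in X) = (v \notin X).
  by move=> vo; have [e /(compatible_ends cj)/hX] := moved_edge cj mA vo.
have le1 : (#|A :&: X| <= #|A :\: X|)%N.
  rewrite -(card_imset _ (@perm_inj _ j.1)); apply/subset_leq_card/subsetP.
  by move=> _ /imsetP[v + ->]; rewrite !inE => /andP[vo vX]; rewrite alt // vX porbit_stable.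
have le2 : (#|A :\: X| <= #|A :&: X|)%N.
  rewrite -(card_imset _ (@perm_inj _ j.1)); apply/subset_leq_card/subsetP.
  by move=> _ /imsetP[v + ->]; rewrite !inE => /andP[vX vo]; rewrite alt // vX porbit_stable.
have eq_o : #|A| = (2 * #|A :&: X|)%N.
  rewrite -(cardsID X A) mul2n -addnn; congr addn.
  by apply/eqP; rewrite eqn_leq le1 le2.
by exists #|A :&: X| => //; move: A1; rewrite eq_o; case: #|_|.
Qed.

Lemma loop_vertices_steps_on j A : compatible j -> A \in moved_orbits j.1 ->
  loop_vertices (steps_on j A) = A.
Proof.
move=> cj mA; apply/setP => v; apply/imsetP/idP => [[s]|vo].
  by rewrite inE => /and3P[so _ _] ->.
have [e fv] := moved_edge cj mA vo; exists ((v, e), j.1 v) => //.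
by rewrite inE vo fv !eqxx.
Qed.

Lemma is_loop_steps_on j A : compatible j -> A \in moved_orbits j.1 ->
  is_loop (steps_on j A).
Proof.
move=> cj mA; have [m m1 card_o] := even_moved_orbit cj mA.
have := mA; rewrite inE => /andP[AP A1].
have /card_gt0P[u uo] : (0 < #|A|)%N by apply: ltnW.
have [e0 _] := moved_edge cj mA uo.
(* The default [e0] only makes [mk] total: every vertex of a moved orbit has a chosen edge. *)
pose mk v : step G := ((v, odflt e0 (j.2 v)), j.1 v).
have orbit_o : orbit j.1 u =i A.
  move=> v; rewrite -fconnect_orbit (mem_porbits_eq AP uo).
  by rewrite porbit_fconnect.
have mkE v : v \in A -> j.2 v = Some (step_edge (mk v)).
  by move=> vo; have [e fv] := moved_edge cj mA vo; rewrite /step_edge /= fv.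
exists m, (map mk (orbit j.1 u)); split.
- by rewrite size_map -card_o -(eq_card orbit_o) (card_uniqP (orbit_uniq _ _)).
- by rewrite -map_comp map_id orbit_uniq.
- by rewrite cycle_map; apply: cycle_orbit; apply: perm_inj.
- move=> _ /mapP[v + ->]; rewrite orbit_o => vo.
  exact: compatible_ends cj (mkE v vo).
apply/setP => s; rewrite !inE; apply/and3P/mapP => [[so /eqP fs /eqP ts]|].
  exists (step_src s); rewrite ?orbit_o // /mk fs -ts /=.
  by case: s {so fs ts} => [[]].
move=> [v + ->]; rewrite orbit_o => vo.
by rewrite mkE // vo !eqxx.
Qed.

Lemma steps_on_inj j : compatible j ->
  {in moved_orbits j.1 &, injective (steps_on j)}.
Proof.
move=> cj A A' mA mA' eo.
by rewrite -(loop_vertices_steps_on cj mA) eo loop_vertices_steps_on.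
Qed.

Lemma loop_family_loops_of j : compatible j -> loop_family (loops_of j).
Proof.
move=> cj; split=> [_ /imsetP[A mA ->]|]; first exact: is_loop_steps_on.
move=> _ _ /imsetP[A mA ->] /imsetP[A' mA' ->] ne.
rewrite !loop_vertices_steps_on //.
apply: (trivIsetP (trivIset_moved_orbits j.1)) => //.
by apply: contraNneq ne => ->.
Qed.

Lemma isolated_loops_of j : compatible j ->
  Defs.isolated (loops_of j) = [set v | j.2 v == None].
Proof.
move=> cj; apply/setP => v; rewrite /Defs.isolated /loops_of big_imset /=; last first.
  exact: steps_on_inj.
rewrite (eq_bigr id) => [|A mA]; last exact: loop_vertices_steps_on.
have := cover_moved_orbits j.1; rewrite /cover => ->.
by rewrite !inE compatible_moved // negbK.
Qed.

Lemma mem_cover_loops_of j (s : step G) : compatible j ->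
  (s \in cover (loops_of j)) = (j.2 (step_src s) == Some (step_edge s))
    && (step_tgt s == j.1 (step_src s)).
Proof.
move=> cj; apply/bigcupP/andP => [[_ /imsetP[A mA ->]]|[fs ts]].
  by rewrite inE => /and3P[].
exists (steps_on j (porbit j.1 (step_src s))).
  by apply: imset_f; rewrite mem_moved_orbits compatible_moved // (eqP fs).
by rewrite inE porbit_id fs.
Qed.

(** The union of the loops records the edge and the image at each moved vertex; every other vertex
    is fixed and carries [None]. *)
Lemma loops_of_inj : {in [pred j | compatible j] &, injective loops_of}.
Proof.
have half j j' : compatible j -> compatible j' -> loops_of j = loops_of j' ->
    forall v e, j.2 v = Some e -> j'.2 v = Some e /\ j'.1 v = j.1 v.
  move=> cj cj' ejj' v e fv.
  have: ((v, e), j.1 v) \in cover (loops_of j).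
    by rewrite mem_cover_loops_of // /step_src /= fv !eqxx.
  by rewrite ejj' mem_cover_loops_of // => /andP[/eqP fv' /eqP ev].
move=> j j'; rewrite !inE => cj cj' ejj'.
have eqv v : j.2 v = j'.2 v /\ j.1 v = j'.1 v.
  case fv: (j.2 v) => [e|].
    by have [-> ->] := half _ _ cj cj' ejj' _ _ fv.
  case fv': (j'.2 v) => [e|].
    by have [+ _] := half _ _ cj' cj (esym ejj') _ _ fv'; rewrite fv.
  split=> //; apply: etrans (_ : v = _).
    by apply/eqP; rewrite -[_ == _]negbK compatible_moved // fv.
  by apply/esym/eqP; rewrite -[_ == _]negbK compatible_moved // fv'.
case: j j' {cj cj' ejj'} eqv => [s f] [s' f'] /= eqv.
congr pair; first by apply/permP => v; case: (eqv v).
by apply/ffunP => v; case: (eqv v).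
Qed.

(** The permutation follows the unique step leaving a vertex, and fixes the vertices that no loop
    visits. *)
Lemma loops_of_surj C : loop_family C -> exists2 j, compatible j & C = loops_of j.
Proof.
move=> famC; have [lC dC] := famC; pose X := cover C.
have src_inj : {in X &, injective (@step_src G)}.
  move=> s t /bigcupP[l Cl sl] /bigcupP[l' Cl' tl'] est.
  have ll' : l = l'.
    apply: (loop_family_inj (v := step_src s) famC Cl Cl'); first exact: imset_f.
    by rewrite est; apply: imset_f.
  by apply: (loop_src_inj (lC l Cl)) => //; rewrite ll'.
have next_X s : s \in X -> exists2 t, t \in X & step_src t = step_tgt s.
  move=> /bigcupP[l Cl sl]; have [t tl et] := loop_next (lC l Cl) sl.
  by exists t => //; apply/bigcupP; exists l.
have tgt_inj : {in X &, injective (@step_tgt G)}.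
  move=> s t /bigcupP[l Cl sl] /bigcupP[l' Cl' tl'] est.
  have ll' : l = l'.
    have [s1 s1l es] := loop_next (lC l Cl) sl.
    have [t1 t1l et] := loop_next (lC l' Cl') tl'.
    apply: (loop_family_inj (v := step_tgt s) famC Cl Cl').
      by rewrite -es; apply: imset_f.
    by rewrite est -et; apply: imset_f.
  by apply: (loop_tgt_inj (lC l Cl)) => //; rewrite ll'.
pose at_src v := [pick s in X | step_src s == v].
have at_srcE s : s \in X -> at_src (step_src s) = Some s.
  move=> sX; rewrite /at_src; case: pickP => [t /andP[tX /eqP/src_inj ->]|/(_ s)] //.
  by rewrite sX eqxx.
pose g v := if at_src v is Some s then step_tgt s else v.
(* Distinct steps have distinct targets, and a target is always the source of a further step, hence
   never an unvisited vertex. *)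
have g_inj : injective g.
  have no s v : s \in X -> at_src v = None -> step_tgt s <> v.
    move=> sX nv sv; have [t tX et] := next_X s sX.
    by have := at_srcE t tX; rewrite et sv nv.
  have atP v s : at_src v = Some s -> s \in X /\ step_src s = v.
    by rewrite /at_src; case: pickP => // t /andP[tX /eqP et] [<-].
  move=> v w; rewrite /g.
  case av: (at_src v) => [s|]; case aw: (at_src w) => [t|] //.
  - have [sX <-] := atP _ _ av; have [tX <-] := atP _ _ aw.
    by move/tgt_inj => ->.
  - by have [sX _] := atP _ _ av; move/(no _ _ sX aw).
  - by have [tX _] := atP _ _ aw; move/esym/(no _ _ tX av).
pose j : permutation_edges :=
  (perm g_inj, [ffun v => omap (@step_edge G) (at_src v)]).
have j1E s : s \in X -> j.1 (step_src s) = step_tgt s.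
  by move=> sX; rewrite permE /g at_srcE.
have j2E s : s \in X -> j.2 (step_src s) = Some (step_edge s).
  by move=> sX; rewrite ffunE at_srcE.
have cj : compatible j.
  apply/forallP => v; rewrite ffunE permE /g /at_src.
  case: pickP => [s /andP[/bigcupP[l Cl sl] /eqP <-]|_] /=; last by rewrite eqxx.
  by rewrite (loop_ends (lC l Cl) sl).
have inX l s : l \in C -> s \in l -> s \in X.
  by move=> Cl sl; apply/bigcupP; exists l.
have stepsE l : l \in C -> steps_on j (loop_vertices l) = l.
  move=> Cl; apply/setP => s; rewrite inE.
  apply/and3P/idP => [[/imsetP[t tl est]]|sl]; last first.
    by rewrite j2E ?j1E ?eqxx ?imset_f //; apply: (inX l).
  rewrite est j2E ?j1E; try exact: inX tl.
  move=> /eqP[ee] /eqP et; suff -> : s = t by [].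
  case: s t est ee et {tl} => [[? ?] ?] [[? ?] ?].
  by rewrite /step_src /step_edge /step_tgt /= => -> -> ->.
(* The sources along a loop form a cycle of the permutation, and such a cycle is a whole orbit. *)
have orbitE l v : l \in C -> v \in loop_vertices l ->
    loop_vertices l = porbit j.1 v.
  move=> Cl vl; have [m [p [_ Up cp _ lE]]] := lC l Cl.
  have cyc : fcycle j.1 (map (@step_src G) p).
    rewrite cycle_map; apply: (sub_in_cycle (P := mem p)) cp => //.
    move=> s t sp tp /= /eqP <-; apply/eqP/j1E/(inX l) => //.
    by rewrite lE inE.
  have memp : loop_vertices l =i map (@step_src G) p.
    move=> w; apply/imsetP/mapP => -[s sl ->]; exists s => //.
      by move: sl; rewrite lE inE.
    by rewrite lE inE.
  apply/setP => w; rewrite porbit_fconnect memp (fconnect_cycle cyc) //.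
  by rewrite -memp.
exists j => //; apply/setP => l; apply/idP/imsetP => [Cl|[A mA ->]].
  have [v vl] := loop_vertices_neq0 (lC l Cl).
  exists (loop_vertices l); last by rewrite stepsE.
  rewrite inE [X in X \in _](orbitE l v) // imset_f //=.
  rewrite card_in_imset; last exact: loop_src_inj (lC l Cl).
  by have [] := card_loop (lC l Cl); case: #|l| => [|[]].
have := mA; rewrite inE => /andP[AP A1].
have /card_gt0P[v vo] : (0 < #|A|)%N by apply: ltnW.
have [e] := moved_edge cj mA vo; rewrite ffunE /at_src.
case: pickP => // s /andP[/bigcupP[l' Cl' sl'] /eqP ev] _.
have vl' : v \in loop_vertices l' by rewrite -ev; apply: imset_f.
by rewrite (mem_porbits_eq AP vo) -(orbitE l' v) // stepsE.
Qed.

Section Weights.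
Variables (R : realType).
Variables (x : V -> R) (a : solid G -> R) (b : dashed G -> R).

(** The sum accounts for different edges with the same ends, which do occur in the wheel of order 1.
    It is empty on the diagonal, where only the vertex weight remains. *)
Definition kasteleyn v w : R[i] :=
  (if w == v then (x v)%:C else 0) +
  \sum_(e | ends e == [set v; w]) step_weight a b ((v, e), w).

(** The contribution of one choice at [v] to a matrix entry; it vanishes exactly on the choices that
    [compatible] rejects, up to zero weights. *)
Definition kasteleyn_term v w (oe : option (edge G)) : R[i] :=
  if oe is Some e then
    if ends e == [set v; w] then step_weight a b ((v, e), w) else 0
  else if w == v then (x v)%:C else 0.

Lemma kasteleyn_sum v w : kasteleyn v w = \sum_oe kasteleyn_term v w oe.
Proof.
rewrite (bigD1 None) //= /kasteleyn; congr (_ + _).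
rewrite (reindex_omap Some id) /=; last by case.
by rewrite big_mkcond /=; apply: eq_big => [e|e _]; rewrite ?eqxx.
Qed.

Lemma configuration_weight_loops_of j : compatible j ->
  configuration_weight x a b (loops_of j)
  = (-1) ^+ j.1 * \prod_v kasteleyn_term v (j.1 v) (j.2 v).
Proof.
move=> cj; rewrite /configuration_weight isolated_loops_of //.
rewrite [in RHS](bigID (fun v => j.2 v == None)) /= mulrCA [LHS]mulrC.
congr (_ * _).
  apply: eq_big => v; rewrite inE // => /eqP fv; rewrite fv /=.
  by rewrite -[_ == _]negbK compatible_moved // fv.
rewrite (eq_bigl (fun v => v \in cover (moved_orbits j.1))); last first.
  by move=> v; rewrite cover_moved_orbits inE compatible_moved.
rewrite big_trivIset; last exact: trivIset_moved_orbits.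
rewrite (sign_perm_porbits j.1) [X in X * _](bigID (fun A => (1 < #|A|)%N)) /=.
rewrite [X in _ * X * _]big1 ?mulr1; last first.
  move=> A /andP[/imsetP[v _ ->]]; rewrite -leqNgt => le1.
  suff -> : #|porbit j.1 v| = 1%N by rewrite exprS expr1 mulrNN mulr1.
  by apply/eqP; rewrite eqn_leq le1 lt0n card_porbit_neq0.
rewrite [X in X * _](eq_bigl (mem (moved_orbits j.1))); last first.
  by move=> A; rewrite [RHS]inE.
rewrite -big_split /loops_of big_imset /=; last exact: steps_on_inj.
apply: eq_bigr => A mA; rewrite /loop_weight.
have [m _ ->] := even_moved_orbit cj mA.
(* The orbit has even length 2m, so its sign (-1)^(2m+1) is the minus sign of the loop weight. *)
rewrite exprS exprM sqrrN expr1n expr1n mulr1 mulN1r; congr (- _).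
have := mA; rewrite inE => /andP[AP A1].
have /card_gt0P[u uo] : (0 < #|A|)%N by apply: ltnW.
have [e0 _] := moved_edge cj mA uo.
pose mk v : step G := ((v, odflt e0 (j.2 v)), j.1 v).
have -> : steps_on j A = mk @: A.
  apply/setP => s; rewrite inE; apply/and3P/imsetP => [[so /eqP fs /eqP ts]|].
    exists (step_src s); rewrite // /mk fs -ts /=.
    by case: s {so fs ts} => [[]].
  move=> [v vo ->]; have [e fv] := moved_edge cj mA vo.
  by rewrite /mk /step_src /step_edge /= vo fv !eqxx.
rewrite big_imset /=; last by move=> v w _ _ [].
apply: eq_bigr => v vo; have [e fv] := moved_edge cj mA vo.
by rewrite /mk fv /= (compatible_ends cj fv) eqxx.
Qed.

Lemma partition_function_expansion :
  partition_function x a b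
  = \sum_(sigma : {perm V}) (-1) ^+ sigma * \prod_v kasteleyn v (sigma v).
Proof.
rewrite partition_function_loop_family.
rewrite (eq_bigl (fun C => C \in loops_of @: [pred j | compatible j])); last first.
  move=> C; apply/asboolP/imsetP => [/loops_of_surj[j cj ->]|[j cj ->]].
    by exists j.
  exact: loop_family_loops_of.
rewrite (big_imset _ loops_of_inj) /=.
rewrite (eq_bigr _ configuration_weight_loops_of).
(* Distributing the product of sums gives one term for each function choosing an option at every
   vertex; the incompatible ones contribute 0. *)
under [RHS]eq_bigr => sigma _.
  under eq_bigr do rewrite kasteleyn_sum.
  rewrite bigA_distr_bigA big_distrr /=.
over.
rewrite pair_bigA /= [RHS](bigID compatible) /= [X in _ + X]big1 ?addr0 //.
move=> j /forallPn[v]; rewrite (bigD1 v) //= => bad.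
suff -> : kasteleyn_term v (j.1 v) (j.2 v) = 0 by rewrite mul0r mulr0.
by move: bad; rewrite /kasteleyn_term; case: (j.2 v) => [e|] /negPf ->.
Qed.

End Weights.
End KasteleynExpansion.

(** * The determinant of the wheel *)

Section UnitCircle.
Variable R : realType.
Implicit Types t u : R.

Definition cis t : R[i] := cos t +i* sin t.

Lemma cisD t u : cis (t + u) = cis t * cis u.
Proof.
apply/eqP; by rewrite eq_complex /= cosD sinD eqxx /= addrC.
Qed.

Lemma cis0 : cis 0 = 1.
Proof. by rewrite /cis cos0 sin0. Qed.

Lemma cisX t k : cis t ^+ k = cis (t *+ k).
Proof. by elim: k => [|k IHk]; rewrite ?cis0 // exprS IHk -cisD mulrS. Qed.

Lemma cis_pi : cis pi = -1.
Proof. by apply/eqP; rewrite eq_complex /= cospi sinpi oppr0 !eqxx. Qed.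

Lemma cis_neq0 t : cis t != 0.
Proof.
apply/eqP => t0; have /eqP := cis0.
by rewrite -(subrr t) cisD t0 mul0r eq_sym oner_eq0.
Qed.

Lemma cisN t : cis (- t) = (cis t)^-1.
Proof.
by apply: (mulfI (cis_neq0 t)); rewrite -cisD subrr cis0 mulfV ?cis_neq0.
Qed.

Lemma cisDcisN t : cis t + (cis t)^-1 = (2 * cos t)%:C.
Proof.
rewrite -cisN; apply/eqP; rewrite eq_complex /= cosN sinN subrr eqxx andbT.
by rewrite mulr_natl mulr2n.
Qed.

(** Since cos t = 1 - 2 sin^2(t/2), the value 1 would force sin(t/2) = 0, whereas t/2 lies strictly
    between 0 and pi. *)
Lemma cis_neq1 t : 0 < t < pi *+ 2 -> cis t != 1.
Proof.
move=> /andP[t0 t2pi]; apply: contraTneq (isT : true) => -[cos1 _].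
have: 0 < sin (t / 2).
  by apply: sin_gt0_pi; rewrite divr_gt0 //= ltr_pdivrMr // mulr_natr.
have: cos t = 1 - sin (t / 2) ^+ 2 *+ 2.
  rewrite -[in LHS](divfK (_ : 2 != 0) t) ?pnatr_eq0 // mulr_natr.
  by rewrite cos_mulr2n cos2sin2; ring.
rewrite cos1 => /eqP; rewrite eq_sym subr_eq addrC -subr_eq subrr eq_sym.
by rewrite mulrn_eq0 expf_eq0 /= => /eqP ->; rewrite ltxx.
Qed.

End UnitCircle.

(** Block LU factorization; [s] is the Schur complement of the upper left block. *)
Lemma det_block_diag (F : fieldType) n (a b c d : 'rV[F]_n) : (forall j, a 0 j != 0) ->
  \det (block_mx (diag_mx a) (diag_mx b) (diag_mx c) (diag_mx d))
  = \prod_j (a 0 j * d 0 j - b 0 j * c 0 j).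
Proof.
move=> a0.
pose s : 'rV[F]_n := \row_j (d 0 j - c 0 j * b 0 j / a 0 j).
have -> : block_mx (diag_mx a) (diag_mx b) (diag_mx c) (diag_mx d)
    = block_mx 1%:M 0 (diag_mx (\row_j (c 0 j / a 0 j))) 1%:M
      *m block_mx (diag_mx a) (diag_mx b) 0 (diag_mx s).
  rewrite mulmx_block !mul1mx !mul0mx !addr0 !mulmx_diag.
  congr block_mx.
    by congr diag_mx; apply/rowP => j; rewrite !mxE divfK.
  rewrite -raddfD /=; congr diag_mx; apply/rowP => j; rewrite !mxE.
  by field; apply: a0.
rewrite det_mulmx det_lblock det_ublock !det1 !mul1r !det_diag -big_split /=.
by apply: eq_bigr => j _; rewrite !mxE; field; apply: a0.
Qed.

Lemma eq_set2 (T : finType) (u v p q : T) :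
  ([set u; v] == [set p; q]) = (u == p) && (v == q) || (u == q) && (v == p).
Proof.
apply/eqP/orP => [/setP e|[/andP[/eqP-> /eqP->]|/andP[/eqP-> /eqP->]]] //.
  move: (e u) (e v) (e p) (e q); rewrite !inE !eqxx !orbT /=.
  move=> /esym/orP[/eqP eu|/eqP eu] /esym/orP[/eqP ev|/eqP ev]; subst;
    rewrite ?eqxx ?orbb ?andbT; do ?[by left|by right].
    by move=> _ /eqP ->; left; rewrite !eqxx.
  by move=> /eqP -> _; left; rewrite !eqxx.
by rewrite setUC.
Qed.

Lemma sum_other_end (T : finType) (V : zmodType) (u v p : T) (h : T -> V) :
  u != v ->
  \sum_(q | [set u; v] == [set p; q]) h q
  = (if u == p then h v else 0) + (if v == p then h u else 0).
Proof.
move=> uv; under eq_bigl do rewrite eq_set2.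
case: (eqVneq u p) uv => [->|_] uv /=.
  rewrite [v == p]eq_sym (negPf uv) addr0.
  by rewrite (big_pred1 v) // => q; rewrite andbF orbF eq_sym.
rewrite add0r; case: eqP => _.
  by rewrite (big_pred1 u) // => q; rewrite andbT eq_sym.
by rewrite big_pred0 // => q; rewrite andbF.
Qed.

(** * Block diagonalization of the wheel matrix *)

Section WheelDeterminant.
Variables (R : realType) (n : nat) (odd_n : odd n) (x a b : R).
Hypothesis x_gt0 : 0 < x.

Let n_gt0 : (0 < n)%N. Proof. by case: n odd_n. Qed.

Local Notation K := (@kasteleyn (wheel odd_n) R (fun=> x) (fun=> a) (fun=> b)).

Lemma ordS_neq (p : 'I_(n + n)) : p != ordS p.
Proof. by apply/eqP => e; have := odd_ordS p; rewrite -e; case: odd. Qed.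

Lemma odd_ord_pred (p : 'I_(n + n)) : odd (ord_pred p) = ~~ odd p.
Proof. by rewrite -[in RHS](ord_predK p) odd_ordS negbK. Qed.

(** The action of K on a vector. Summing over edges first, only the solid edges indexed by p and its
    predecessor and one dashed edge meet p; solid edges leave even vertices, whence the sign
    (-1)^p. *)
Lemma kasteleyn_wheel (h : 'I_(n + n) -> R[i]) (p : 'I_(n + n)) :
  \sum_q K p q * h q = x%:C * h p
    + (-1) ^+ p * a%:C * (h (ordS p) + h (ord_pred p))
    + (0 +i* b) * (match fintype.split p with inl d => h (rshift n d)
                                    | inr d => h (lshift n d) end).
Proof.
have ib : (0 +i* 1) * b%:C = 0 +i* b.
  by apply/eqP; rewrite eq_complex /= !mul0r !mul1r subr0 add0r !eqxx.
rewrite -addrA; under eq_bigr do rewrite /kasteleyn mulrDl.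
rewrite big_split /=; congr (_ + _).
  by rewrite (bigD1 p) //= eqxx big1 ?addr0 // => q /negPf ->; rewrite mul0r.
under eq_bigr do rewrite big_distrl /=.
rewrite (exchange_big_dep predT) //= big_sumType /=; congr (_ + _).
  under eq_bigr => r _ do rewrite /wheel_solid_ends sum_other_end ?ordS_neq //.
  rewrite big_split /= -big_mkcond big_pred1_eq -big_mkcond /=.
  rewrite (big_pred1 (ord_pred p)) => [|r]; last first.
    by rewrite /= -[RHS](can_eq (@ordSK _)) ord_predK.
  rewrite /step_weight /step_edge /step_src /= /wheel_solid_tail odd_ord_pred.
  rewrite ord_predK mulrDr -[(-1) ^+ p]signr_odd.
  case: odd => /=; last by rewrite !eqxx !mul1r.
  rewrite (negPf (ordS_neq p)) eq_sym -[X in _ == X]ord_predK.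
  by rewrite (negPf (ordS_neq _)) expr1 !mulN1r.
under eq_bigr => d _.
  rewrite /wheel_dashed_ends sum_other_end; last by rewrite eq_lrshift.
over.
rewrite /step_weight /step_edge /= ib big_split /= -!big_mkcond /=.
case: (split_ordP p) => d ->.
  rewrite (big_pred1 d) => [|r]; last by rewrite eq_lshift.
  by rewrite big_pred0 ?addr0 // => r; rewrite eq_rlshift.
rewrite [X in _ + X](big_pred1 d) => [|r]; last by rewrite eq_rshift.
by rewrite big_pred0 ?add0r // => r; rewrite eq_lrshift.
Qed.

Let zeta : R[i] := cis (pi / n%:R).

Lemma zetaX k : zeta ^+ k = cis (pi * k%:R / n%:R).
Proof. by rewrite cisX -[_ *+ k]mulr_natr mulrAC. Qed.

Lemma zetaXn : zeta ^+ n = -1.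
Proof. by rewrite zetaX mulfK ?cis_pi // pnatr_eq0 -lt0n. Qed.

(** The quotient of two such powers is [cis] of an angle strictly between 0 and 2 pi. This makes the
    Vandermonde matrix [fourier] invertible. *)
Lemma zeta_inj (i j : 'I_(n + n)) : zeta ^+ i = zeta ^+ j -> i = j.
Proof.
have lt_neq (k l : 'I_(n + n)) : (k < l)%N -> zeta ^+ k != zeta ^+ l.
  move=> kl; rewrite -(subnKC (ltnW kl)) exprD -subr_eq0 -{1}[zeta ^+ k]mulr1.
  rewrite -mulrBr mulf_neq0 //; first by rewrite expf_neq0 ?cis_neq0.
  rewrite subr_eq0 eq_sym zetaX cis_neq1 // divr_gt0 ?mulr_gt0 ?pi_gt0 //=.
  - rewrite ltr_pdivrMr ?ltr0n // -[pi *+ 2]mulr_natr -mulrA -natrM.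
    rewrite ltr_pM2l ?pi_gt0 // ltr_nat mul2n -addnn.
    by rewrite (leq_ltn_trans (leq_subr _ _)).
  - by rewrite ltr0n subn_gt0.
  - by rewrite ltr0n.
move=> e; apply/val_inj; case: (ltngtP i j) => // /lt_neq.
  by rewrite e eqxx.
by rewrite e eqxx.
Qed.

Let fourier : 'M[R[i]]_(n + n) := Vandermonde (n + n) (\row_j zeta ^+ j).

Lemma det_fourier_neq0 : \det fourier != 0.
Proof.
rewrite det_Vandermonde; apply/prodf_neq0 => i _; apply/prodf_neq0 => j ij.
rewrite !mxE subr_eq0; apply: contraTneq ij => /zeta_inj ->.
by rewrite ltnn.
Qed.

(** The shift by n multiplies the j-th Fourier vector by (-1)^j, and the two unit shifts together by
    2 cos(pi j / n). The alternating sign (-1)^p then turns w^p into (-w)^p, the Fourier vector of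
    index j + n. *)
Lemma kasteleyn_fourier (p j : 'I_(n + n)) :
  \sum_q K p q * (zeta ^+ j) ^+ q
  = (x%:C + (0 +i* b) * (-1) ^+ j) * (zeta ^+ j) ^+ p
    + (a * (2 * cos (pi * j%:R / n%:R)))%:C * (- zeta ^+ j) ^+ p.
Proof.
set w := zeta ^+ j.
have w0 : w != 0 by rewrite expf_neq0 ?cis_neq0.
have wn : w ^+ n = (-1) ^+ j by rewrite /w exprAC zetaXn.
have w2n : w ^+ (n + n) = 1 by rewrite exprD wn -expr2 sqrr_sign.
have wS (q : 'I_(n + n)) : w ^+ (ordS q) = w * w ^+ q.
  by rewrite /= expr_mod // exprS.
rewrite kasteleyn_wheel wS -[w ^+ ord_pred p](mulKf w0) -[w * w ^+ ord_pred p]wS ord_predK.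
rewrite -mulrDl rmorphM /= -cisDcisN -zetaX -/w (exprNn w).
have -> : match fintype.split p with inl d => w ^+ rshift n d | inr d => w ^+ lshift n d end
    = (-1) ^+ j * w ^+ p.
  rewrite -wn; case: (split_ordP p) => d -> /=; first by rewrite exprD.
  by rewrite exprD mulrA -exprD w2n mul1r.
ring.
Qed.

Lemma det_kasteleyn_wheel :
  \det (\matrix_(p < n + n, q < n + n) K p q)
  = (\prod_(0 <= j < n)
       (x ^+ 2 + b ^+ 2 + 4 * a ^+ 2 * cos (pi * j%:R / n%:R) ^+ 2))%:C.
Proof.
pose mu (s : R[i]) := \row_(j < n) (x%:C + s * (0 +i* b) * (-1) ^+ j).
pose la (s : R[i]) := \row_(j < n) (s * (a * (2 * cos (pi * j%:R / n%:R)))%:C).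
pose D := block_mx (diag_mx (mu 1)) (diag_mx (la (-1)))
                   (diag_mx (la 1)) (diag_mx (mu (-1))).
have KF : (\matrix_(p, q) K p q) *m fourier = fourier *m D.
  rewrite -[in RHS](hsubmxK fourier) mul_row_block !mul_mx_diag.
  apply/matrixP => p j; rewrite mxE.
  under eq_bigr do rewrite !mxE.
  rewrite kasteleyn_fourier; case: (split_ordP j) => k ->.
    rewrite row_mxEl !mxE /= exprD zetaXn mulN1r; ring.
  (* For the index n + k with n odd, both the sign (-1)^(n+k) and the cosine are opposite to those
     at k; hence the arguments -1 in the second block column of [D]. *)
  rewrite row_mxEr !mxE /= !exprD zetaXn -signr_odd odd_n.
  have -> : cos (pi * (n + k)%:R / n%:R) = - cos (pi * k%:R / n%:R) :> R.
    rewrite natrD mulrDr mulrDl mulfK ?pnatr_eq0 -?lt0n // addrC.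
    exact: cosDpi.
  rewrite !mulrN rmorphN /= !mulN1r opprK; ring.
have : \det ((\matrix_(p, q) K p q) *m fourier) = \det (fourier *m D).
  by rewrite KF.
rewrite !det_mulmx mulrC => /(mulfI det_fourier_neq0) ->.
(* The entries of [mu 1] are nonzero because their real part is x > 0. *)
rewrite det_block_diag => [|j]; last first.
  rewrite mxE mul1r -signr_odd; case: odd;
    by rewrite ?expr1 ?mulrN1 ?mulr1 eq_complex /= ?oppr0 addr0 gt_eqF.
rewrite big_mkord rmorph_prod; apply: eq_bigr => j _; rewrite !mxE.
have i2 : (0 +i* b) * (0 +i* b) = - (b ^+ 2)%:C :> R[i].
  by apply/eqP; rewrite eq_complex /= !mul0r !mulr0 sub0r addr0 oppr0 !eqxx.
have e2 : (-1) ^+ j * (-1) ^+ j = 1 :> R[i] by rewrite -expr2 sqrr_sign.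
transitivity (x%:C ^+ 2 - ((0 +i* b) * (0 +i* b)) * ((-1) ^+ j * (-1) ^+ j)
    + (a * (2 * cos (pi * j%:R / n%:R)))%:C ^+ 2); first by ring.
rewrite i2 e2 mulr1 opprK -!rmorphXn -!rmorphD /=; congr (_%:C); ring.
Qed.

End WheelDeterminant.

(** * Folding the product and conclusion *)

Lemma prod_nat_odd_symmetric (R : comPzRingType) (f : nat -> R) (n : nat) :
  odd n -> (forall j, (j <= n)%N -> f (n - j)%N = f j) ->
  \prod_(0 <= j < n) f j
  = f 0%N * \prod_(1 <= j < (n - 1)./2.+1) f j ^+ 2.
Proof.
move=> odd_n fsym; have nE : n = (n./2 + n./2).+1.
  by rewrite -{1}(odd_double_half n) odd_n addnn.
set m := n./2 in nE; have -> : (n - 1)./2 = m.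
  by rewrite nE subn1 /= addnn doubleK.
rewrite {1}nE big_ltn // (@big_cat_nat _ _ _ m.+1) ?ltnS ?leq_addr //=.
(* With n = 2m + 1, the indices m+1, ..., 2m are shifted down by m and then reversed, so that n - j
   meets j for each j from 1 to m. *)
congr (_ * _); rewrite -[in X in _ * X](addn1 m) addnC big_addn -addSn addnK.
rewrite [X in _ * X]big_nat_rev -big_split /=; apply: eq_big_nat => j /andP[j1 jm].
suff -> : (1 + m.+1 - j.+1 + m)%N = (n - j)%N.
  by rewrite fsym ?expr2 // nE (leq_trans (ltnW jm)) // ltnS leq_addr.
by rewrite subSS addnC addnBA ?add0n; [rewrite nE addnS | exact: ltnW].
Qed.

Theorem theorem4p5 (R : realType) (n : nat) (odd_n : odd n) (x a b : R)
    (x_gt0 : 0 < x) (a_gt0 : 0 < a) (b_gt0 : 0 < b) :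
  @partition_function (wheel odd_n) R (fun=> x) (fun=> a) (fun=> b)
  = (\prod_(0 <= j < n)
       (x ^+ 2 + b ^+ 2 + 4 * a ^+ 2 * cos (pi * j%:R / n%:R) ^+ 2))%:C
  /\
  \prod_(0 <= j < n)
    (x ^+ 2 + b ^+ 2 + 4 * a ^+ 2 * cos (pi * j%:R / n%:R) ^+ 2)
  = (x ^+ 2 + b ^+ 2 + 4 * a ^+ 2) *
    \prod_(1 <= j < (n - 1)./2.+1)
      (x ^+ 2 + b ^+ 2 + 4 * a ^+ 2 * cos (pi * j%:R / n%:R) ^+ 2) ^+ 2.
Proof.
split.
  rewrite -(det_kasteleyn_wheel odd_n a b x_gt0) partition_function_expansion.
  apply: eq_bigr => sigma _; congr (_ * _).
  by apply: eq_bigr => p _; rewrite mxE.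
have n0 : n%:R != 0 :> R by rewrite pnatr_eq0; case: n odd_n.
rewrite prod_nat_odd_symmetric // => [|j jn].
  by rewrite mulr0 mul0r cos0 expr1n mulr1.
(* The symmetry j to n - j is cos(pi - t) = -cos t, whose sign disappears in the square. *)
rewrite natrB // mulrBr mulrBl mulfK // cosB cospi sinpi mul0r addr0 mulN1r.
by rewrite sqrrN.
Qed.
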